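(* Let $\mathcal{F}$ be a covering by the infinite square grid $G(\mathbb{Z}^2)$, i.e. a perfect coloring of $G(\mathbb{Z}^2)$ whose quotient matrix is a $\{0,1\}$-matrix with zero diagonal. Then $\mathcal{F}$ is an orbit coloring or $\mathcal{F}$ has (at least one pair of) twin colors.
   Context: $G(\mathbb{Z}^2)$ is the graph on vertex set $\mathbb{Z}^2$ (nodes $[x,y]$) in which $[x,y]$ and $[x',y']$ are adjacent iff $|x-x'|+|y-y'|=1$. A perfect coloring with quotient matrix $S=(S_{ij})_{i,j=1}^n$ is a surjective function $\mathcal{F}$ from $\mathbb{Z}^2$ onto a set of $n$ colors $\{1,\dots,n\}$ such that every node of color $i$ has exactly $S_{ij}$ neighbors of color $j$, for all $i,j$. Two distinct colors $a,b$ are twin if identifying them (replacing $b$ by $a$) yields again a perfect coloring (with $n-1$ colors); equivalently $S_{aj}=S_{bj}$ for all $j\ne a,b$. An automorphism of $G(\mathbb{Z}^2)$ is an adjacency-preserving bijection of $\mathbb{Z}^2$ (translations, rotations, reflections and their compositions). $\mathcal{F}$ is an orbit coloring if its color classes are the orbits of some group of automorphisms of $G(\mathbb{Z}^2)$; equivalently, for any two nodes $\bar x,\bar y$ of the same color there is an automorphism $\phi$ with $\phi(\bar x)=\bar y$ and $\mathcal{F}(\phi(\bar u))=\mathcal{F}(\bar u)$ for all $\bar u\in\mathbb{Z}^2$. *)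

(* Defs.v *)
From HB Require Import structures.
From mathcomp Require Import all_boot all_order all_algebra.
From mathcomp Require Import zify.

Set Implicit Arguments.
Unset Strict Implicit.
Unset Printing Implicit Defensive.

Import Order.TTheory GRing.Theory Num.Theory.
Local Open Scope ring_scope.

Definition node : Type := (int * int)%type.

Definition adj : rel node :=
  fun u v => `|u.1 - v.1| + `|u.2 - v.2| == 1.

(* The finite neighbourhood as a list, so that neighbours can be counted;
   uniq_nbrs and mem_nbrs tie it to adj. *)
Definition nbrs (u : node) : seq node :=
  [:: (u.1 + 1, u.2); (u.1 - 1, u.2); (u.1, u.2 + 1); (u.1, u.2 - 1)].

Lemma uniq_nbrs (u : node) : uniq (nbrs u).
Proof. by case: u => x y; rewrite /= !inE !xpair_eqE; lia. Qed.

Lemma mem_nbrs (u v : node) : (v \in nbrs u) = adj u v.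
Proof.
case: u v => [x y] [x' y']; rewrite /nbrs /adj !inE !xpair_eqE /=; lia.
Qed.

(* F is a perfect coloring with color set D; only the entries of S indexed by D
   are relevant. *)
Definition perfect_coloring (C : finType) (D : {set C}) (F : node -> C)
    (S : C -> C -> nat) : Prop :=
  [/\ forall u, F u \in D,
      forall c, c \in D -> exists u, F u = c &
      forall i j, i \in D -> j \in D -> forall u, F u = i ->
        count (fun v => F v == j) (nbrs u) = S i j].

Definition covering (n : nat) (F : node -> 'I_n) (S : 'M[nat]_n) : Prop :=
  [/\ perfect_coloring [set: 'I_n] F S,
      forall i j, S i j = 0%N \/ S i j = 1%N &
      forall i, S i i = 0%N].

Definition identify (C : finType) (a b : C) (c : C) : C :=
  if c == b then a else c.

Definition twin (C : finType) (F : node -> C) (a b : C) : Prop :=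
  a <> b /\ exists S : C -> C -> nat,
    perfect_coloring [set~ b] (identify a b \o F) S.

Definition automorphism (f : node -> node) : Prop :=
  bijective f /\ forall u v, adj (f u) (f v) = adj u v.

Definition automorphism_group (H : (node -> node) -> Prop) : Prop :=
  [/\ forall f, H f -> automorphism f,
      H id,
      forall f g, H f -> H g -> H (f \o g) &
      forall f, H f -> exists g, [/\ H g, cancel f g & cancel g f]].

Definition orbit_coloring (C : finType) (F : node -> C) : Prop :=
  exists2 H : (node -> node) -> Prop, automorphism_group H &
    forall u v, F u = F v <-> exists2 f, H f & f u = v.

(* Main.v *)
(** Let [E] be the 4-regular simple graph on the colors given by the quotient
    matrix, and assume that no two colors are twins.  If [F u = F v], matching
    the colors of the neighbors of [u] and [v] gives a bijection between the two
    neighborhoods.  If it always maps opposite neighbors to opposite neighbors,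
    then some symmetry of the grid matches the unit balls around [u] and [v];
    it must also match the corners of the balls of radius 2, since otherwise
    these corners are colored [p, q, p, q] and [p] is a twin of [F u]; hence the
    matching propagates to the whole grid and [F] is an orbit coloring.

    Otherwise the unit balls around [u] and [v] are, up to symmetry, in one
    fixed conflicting position.  A finite search over the colorings of
    neighborhoods of [u] and [v] with that position either exhibits twin colors
    or determines [E] completely (a graph with 8, 10, 12 or 16 vertices).
    In the latter case the ball of radius 2 around [u] takes part in a finite
    family of colored balls closed under passing to an adjacent center, and no
    member of this family has the arrangement of neighbors found around [v]. *)

Require Import Defs.
From mathcomp Require Import all_boot all_order all_algebra.
From mathcomp Require Import zify.

Set Implicit Arguments.
Unset Strict Implicit.
Unset Printing Implicit Defensive.

Import Order.TTheory GRing.Theory Num.Theory.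

(** * The search *)

(* A partial coloring of two patches of the grid, distinguished by a boolean.
   Positions are natural numbers, the center of a patch being [(3, 3)]; colors
   are labels [0, 1, ...], distinct labels standing for distinct colors. *)
Definition pos := (nat * nat)%type.
Definition cell := (bool * pos * nat)%type.
(* The first component lists, for every label, the labels known to be adjacent
   to it in the color graph. *)
Definition state := (seq (seq nat) * seq cell)%type.

Definition pos_dist (p q : pos) : nat :=
  (p.1 - q.1) + (q.1 - p.1) + ((p.2 - q.2) + (q.2 - p.2)).

Definition full (l : seq nat) : bool := size l == 4.

(** [None] signals a contradiction: a fifth neighbor in a 4-regular color graph. One call records
    one direction of the edge. *)
Definition add_link (N : seq (seq nat)) (a b : nat) : option (seq (seq nat)) :=
  let l := nth [::] N a in
  if b \in l then Some N
  else if full l then None else Some (set_nth [::] N a (b :: l)).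

(** Cells at distance 1 have adjacent, hence distinct, colors; cells at distance 2 have a common
    neighbor, around which a covering is injective. A repeated label in either case is a
    contradiction. *)
Fixpoint link_cells (k : bool) (p : pos) (c : nat) (cs : seq cell)
    (N : seq (seq nat)) : option (seq (seq nat)) :=
  if cs is (k', p', c') :: cs' then
    let d := pos_dist p p' in
    if (k == k') && (0 < d <= 2) then
      if c == c' then None
      else if d == 1 then
        obind (fun N1 => obind (link_cells k p c cs') (add_link N1 c' c))
          (add_link N c c')
      else link_cells k p c cs' N
    else link_cells k p c cs' N
  else Some N.

Definition place (s : state) (k : bool) (p : pos) (c : nat) : option state :=
  omap (fun N => (N, (k, p, c) :: s.2)) (link_cells k p c s.2 s.1).

Definition fresh (s : state) : state := (rcons s.1 [::], s.2).

(* The label [size s.1] stands for a color not seen so far. *)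
Definition assign (s : state) (k : bool) (p : pos) (c : nat) : option state :=
  place (if c == size s.1 then fresh s else s) k p c.

(** An adjacent cell whose label has all four links known leaves only those four labels for [p];
    this bounds the branching. *)
Fixpoint full_neighbor (N : seq (seq nat)) (k : bool) (p : pos)
    (cs : seq cell) : option nat :=
  if cs is (k', p', c') :: cs' then
    if [&& k == k', pos_dist p p' == 1 & full (nth [::] N c')] then Some c'
    else full_neighbor N k p cs'
  else None.

Definition candidates (s : state) (k : bool) (p : pos) : seq nat :=
  if full_neighbor s.1 k p s.2 is Some c then nth [::] s.1 c
  else iota 0 (size s.1).+1.

Fixpoint explore (prune : state -> bool) (order : seq (bool * pos))
    (s : state) : seq state :=
  if prune s then [::]
  else if order is (k, p) :: order' then
    flatten [seq (if assign s k p c is Some s' then explore prune order' s'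
                  else [::]) | c <- candidates s k p]
  else [:: s].

(** Only full lists are exact neighborhoods, so the comparison is conclusive only when both are
    full. *)
Definition twin_labels (N : seq (seq nat)) (a b : nat) : bool :=
  let la := nth [::] N a in let lb := nth [::] N b in
  [&& full la, full lb, all (mem (b :: lb)) la & all (mem (a :: la)) lb].

Definition has_twin_labels (s : state) : bool :=
  has (fun a => has (twin_labels s.1 a) (iota 0 a)) (iota 0 (size s.1)).

(* Label [0] in both centers, [1] to the right and [4] below in both patches,
   but [2] and [3] exchanged, so that the opposite of [1] differs. *)
Definition conflict : state :=
  ([:: [:: 1; 2; 3; 4]; [:: 0]; [:: 0]; [:: 0]; [:: 0]],
   [:: (false, (3, 3), 0); (false, (4, 3), 1); (false, (2, 3), 2);
       (false, (3, 4), 3); (false, (3, 2), 4);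
       (true, (3, 3), 0); (true, (4, 3), 1); (true, (2, 3), 3);
       (true, (3, 4), 2); (true, (3, 2), 4)]).

(* Any order is sound; this one was found by experiment to keep the search
   small. *)
Definition conflict_order : seq (bool * pos) :=
  [seq (false, p) | p <- [:: (2, 2); (2, 4); (4, 4); (4, 2)]] ++
  [seq (true, p) | p <- [:: (4, 4); (2, 2); (4, 2); (2, 4)]] ++
  [seq (false, p) | p <- [:: (3, 1); (1, 3); (3, 5); (2, 5); (4, 5); (2, 1);
                             (1, 2); (4, 1); (5, 3); (1, 4); (5, 2); (5, 4)]] ++
  [seq (true, p) | p <- [:: (3, 5); (2, 5)]] ++
  [seq (false, p) | p <- [:: (1, 1); (5, 1); (5, 5)]].

Definition survivors : seq state :=
  explore has_twin_labels conflict_order conflict.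

(** * Families of colored balls closed under unit shifts *)

Definition ball2 : seq pos :=
  [:: (3, 3); (4, 3); (2, 3); (3, 4); (3, 2); (4, 4); (2, 4); (2, 2); (4, 2);
      (5, 3); (1, 3); (3, 5); (3, 1)].

(* Translation by [e - (1, 1)]: offsets are stored with 1 added. *)
Definition shift_pos (e p : pos) : pos := (p.1 + e.1 - 1, p.2 + e.2 - 1).

(* Each unit translation, with the positions it adds to [ball2]. *)
Definition shifts : seq (pos * seq pos) :=
  [:: ((2, 1), [:: (5, 4); (5, 2); (4, 5); (4, 1); (6, 3)]);
      ((0, 1), [:: (1, 4); (1, 2); (2, 5); (2, 1); (0, 3)]);
      ((1, 2), [:: (4, 5); (2, 5); (5, 4); (1, 4); (3, 6)]);
      ((1, 0), [:: (4, 1); (2, 1); (5, 2); (1, 2); (3, 0)])].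

(* An unlabeled position gets [size s.1], which is not a label of [s]. *)
Definition label (s : state) (k : bool) (p : pos) : nat :=
  foldr (fun x c => if (x.1.1 == k) && (x.1.2 == p) then x.2 else c)
    (size s.1) s.2.

Definition window (e : pos) (s : state) : seq nat :=
  [seq label s false (shift_pos e p) | p <- ball2].

Definition window_state (N : seq (seq nat)) (w : seq nat) : state :=
  (N, [seq (false, q.1, q.2) | q <- zip ball2 w]).

Definition window_extensions (N : seq (seq nat)) (w : seq nat)
    (new : seq pos) : seq state :=
  explore xpred0 [seq (false, p) | p <- new] (window_state N w).

(** Nothing is proved about this computation: [shift_closed] and a membership test recheck its
    result. Exhausted fuel yields the empty family, which fails the membership test. *)
Fixpoint window_closure (fuel : nat) (N : seq (seq nat))
    (seen todo : seq (seq nat)) :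
    seq (seq nat) :=
  if fuel is fuel'.+1 then
    if todo is w :: todo' then
      if w \in seen then window_closure fuel' N seen todo'
      else window_closure fuel' N (w :: seen)
        (flatten [seq [seq window sh.1 s | s <- window_extensions N w sh.2]
                 | sh <- shifts] ++ todo')
    else seen
  else [::].

(** The equality of sizes says that no extension introduces a new color. *)
Definition shift_closed (N : seq (seq nat)) (G : seq (seq nat)) : bool :=
  all (fun w =>
    [&& size w == size ball2, all (fun c => c < size N) w &
        all (fun sh =>
          all (fun s => (size s.1 == size N) && (window sh.1 s \in G))
            (window_extensions N w sh.2)) shifts]) G.

(** [ball2] begins with center, right, left, up, down, so these are the two pairs of opposite
    neighbors. In [conflict], label 1 is opposite to 3 around the second center and to 2 around the
    first. *)
Definition conflict_window (w : seq nat) : bool :=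
  (nth 0 w 0 == 0) &&
  has (fun q => q \in [:: (1, 3); (3, 1)])
    [:: (nth 0 w 1, nth 0 w 2); (nth 0 w 3, nth 0 w 4)].

Definition conflict_free (s : state) : bool :=
  let G := window_closure 300 s.1 [::] [:: window (1, 1) s] in
  [&& window (1, 1) s \in G, shift_closed s.1 G &
      all (predC conflict_window) G].

Lemma survivors_conflict_free : all conflict_free survivors.
Proof. by vm_compute. Qed.

(** * Soundness of the search *)

(** A covering map of graphs: a homomorphism that is bijective on each neighborhood. *)
Definition graph_cover (C : Type) (E : rel C) (f : node -> C) : Prop :=
  [/\ forall u v, adj u v -> E (f u) (f v),
      forall u v w, adj u v -> adj u w -> f v = f w -> v = w &
      forall u c, E (f u) c -> exists2 v, adj u v & f v = c].

Definition twin_free (C : eqType) (E : rel C) : Prop :=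
  forall a b, a != b -> exists c, [/\ c != a, c != b & E a c != E b c].

Lemma adj_sym : symmetric adj.
Proof. by move=> [x y] [x' y']; rewrite /adj /=; lia. Qed.

Definition node_of_pos (p : pos) : node := (p.1%:Z - 3, p.2%:Z - 3)%R.

Lemma adj_node_of_pos (p q : pos) :
  pos_dist p q = 1 -> adj (node_of_pos p) (node_of_pos q).
Proof. by case: p q => [x y] [x' y']; rewrite /pos_dist /adj /=; lia. Qed.

Lemma common_neighbor (p q : pos) : pos_dist p q = 2 ->
  exists2 w, adj w (node_of_pos p) & adj w (node_of_pos q).
Proof.
case: p q => [x y] [x' y']; rewrite /pos_dist /= => d2.
have [lt_x|lt_x|eq_x] := ltngtP x x'.
(* The center (3, 3) is sent to 0, so [x - 2] is the abscissa one step to the right of [p]; the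
   witness is always one step from [p] towards [p']. *)
- by exists (x%:Z - 2, y%:Z - 3)%R; rewrite /adj /=; lia.
- by exists (x%:Z - 4, y%:Z - 3)%R; rewrite /adj /=; lia.
have [lt_y|le_y] := ltnP y y'.
- by exists (x%:Z - 3, y%:Z - 2)%R; rewrite /adj /=; lia.
by exists (x%:Z - 3, y%:Z - 4)%R; rewrite /adj /=; lia.
Qed.

Section Soundness.

Variables (C : finType) (E : rel C) (f : bool -> node -> C) (x0 : C).
Hypothesis E_irr : irreflexive E.
Hypothesis E_deg : forall c, #|E c| = 4.
Hypothesis f_cover : forall k, graph_cover E (f k).

Local Notation color r := (nth x0 r).

(** [r] interprets labels as colors. As [r] and the lists have no duplicates, a list of length four
    is a complete neighborhood. *)
Definition links_sound (r : seq C) (N : seq (seq nat)) : Prop :=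
  [/\ uniq r, size N = size r,
      forall a, uniq (nth [::] N a) &
      forall a b, b \in nth [::] N a ->
        b < size r /\ E (color r a) (color r b)].

Definition cells_sound (r : seq C) (cs : seq cell) : Prop :=
  forall k p c, (k, p, c) \in cs ->
    c < size r /\ f k (node_of_pos p) = color r c.

Definition realizes (r : seq C) (s : state) : Prop :=
  links_sound r s.1 /\ cells_sound r s.2.

Lemma full_linksP r N a c : links_sound r N -> full (nth [::] N a) ->
  reflect (exists2 b, b \in nth [::] N a & c = color r b) (E (color r a) c).
Proof.
case=> uniq_r szN uniqN linkN /eqP full_a.
set s := [seq color r b | b <- nth [::] N a].
have uniq_s : uniq s.
  rewrite map_inj_in_uniq // => b b' /linkN[lt_b _] /linkN[lt_b' _] /eqP.
  by rewrite nth_uniq // => /eqP.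
have sub_s : {subset s <= enum (E (color r a))}.
  by move=> _ /mapP[b /linkN[_ Eab] ->]; rewrite mem_enum.
have /(uniq_min_size uniq_s sub_s)[_ eq_s] :
    size (enum (E (color r a))) <= size s.
  by rewrite -cardE E_deg size_map full_a.
have -> : E (color r a) c = (c \in s) by rewrite eq_s mem_enum.
exact: mapP.
Qed.

Lemma add_link_sound r N a b : links_sound r N ->
    a < size r -> b < size r -> E (color r a) (color r b) ->
  exists2 N', add_link N a b = Some N' & links_sound r N'.
Proof.
move=> snd lt_a lt_b Eab; rewrite /add_link.
have [uniq_r szN uniqN linkN] := snd.
have [b_in|b_notin] := boolP (b \in _); first by exists N.
(* A full list contains every neighbor of [a], so [b] would already be in it. *)
have [full_a|_] := boolP (full _).
  have /(full_linksP _ snd full_a)[b' b'_in /eqP] := Eab.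
  have [lt_b' _] := linkN _ _ b'_in.
  rewrite nth_uniq // => /eqP eq_b.
  by rewrite eq_b b'_in in b_notin.
eexists; first by []; split=> //.
- by rewrite size_set_nth szN; apply/maxn_idPr.
- move=> a'; rewrite nth_set_nth /=.
  by case: eqP => //= _; rewrite b_notin uniqN.
move=> a' b'; rewrite nth_set_nth /=; case: eqP => [->|_]; last exact: linkN.
by rewrite inE => /orP[/eqP-> //|]; apply: linkN.
Qed.

Lemma link_cells_sound r k p c cs N : links_sound r N -> cells_sound r cs ->
    c < size r -> f k (node_of_pos p) = color r c ->
  exists2 N', link_cells k p c cs N = Some N' & links_sound r N'.
Proof.
move=> sndN snd_cs lt_c fc; have [f_adj f_inj _] := f_cover k.
elim: cs N sndN snd_cs => [|[[k' p'] c'] cs IHcs] N sndN snd_cs /=.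
  by exists N.
have IH N' : links_sound r N' ->
    exists2 N'', link_cells k p c cs N' = Some N'' & links_sound r N''.
  move=> sndN'; apply: IHcs => // k1 p1 c1 in_cs; apply: snd_cs.
  by rewrite inE in_cs orbT.
case: ifP => [/andP[/eqP eq_k /andP[d_gt0 d_le2]]|_]; last exact: IH.
have [|lt_c' fc'] := snd_cs k' p' c'; first by rewrite inE eqxx.
rewrite -eq_k in fc'.
have [d1|d_neq1] := eqVneq (pos_dist p p') 1.
  have adj_pp' := adj_node_of_pos d1.
  have Ecc' : E (color r c) (color r c') by rewrite -fc -fc'; apply: f_adj.
  have Ec'c : E (color r c') (color r c).
    by rewrite -fc -fc'; apply: f_adj; rewrite adj_sym.
  have [eq_c|_] := eqVneq c c'; first by rewrite eq_c E_irr in Ecc'.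
  have [N1 -> snd1] := add_link_sound sndN lt_c lt_c' Ecc'.
  have [N2 /= -> snd2] := add_link_sound snd1 lt_c' lt_c Ec'c.
  exact: IH.
have d2 : pos_dist p p' = 2 by move: d_gt0 d_le2 d_neq1; lia.
have [w adj_wp adj_wp'] := common_neighbor d2.
have [eq_c|_] := eqVneq c c'; last exact: IH.
have /(f_inj w _ _ adj_wp adj_wp') : f k (node_of_pos p) = f k (node_of_pos p').
  by rewrite fc fc' eq_c.
move: d2; case: (p) (p') => [x y] [x' y']; rewrite /pos_dist /node_of_pos /=.
by move=> d2 []; lia.
Qed.

Lemma place_sound r s k p c : realizes r s -> c < size r ->
    f k (node_of_pos p) = color r c ->
  exists2 s', place s k p c = Some s' & realizes r s'.
Proof.
case=> sndN snd_cs lt_c fc.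
have [N eqN sndN'] := link_cells_sound sndN snd_cs lt_c fc.
exists (N, (k, p, c) :: s.2); first by rewrite /place eqN.
split=> // k' p' c'; rewrite inE => /orP[/eqP[-> -> ->] //|].
exact: snd_cs.
Qed.

Lemma fresh_sound r s x :
  realizes r s -> x \notin r -> realizes (rcons r x) (fresh s).
Proof.
move=> [[uniq_r szN uniqN linkN] snd_cs] x_notin; split; first split.
- by rewrite rcons_uniq x_notin.
- by rewrite !size_rcons szN.
- move=> a /=; rewrite nth_rcons; case: ifP => // _.
  by case: ifP.
- move=> a b /=; rewrite nth_rcons szN; case: ltnP => [lt_a|_]; last first.
    by case: eqP.
  move=> /linkN[lt_b Eab]; rewrite size_rcons ltnS ltnW //; split=> //.
  by rewrite !nth_rcons lt_a lt_b.
move=> k p c /snd_cs[lt_c fc]; rewrite size_rcons ltnS ltnW //; split=> //.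
by rewrite nth_rcons lt_c.
Qed.

Lemma full_neighbor_sound r N k p cs c : cells_sound r cs ->
    full_neighbor N k p cs = Some c ->
  full (nth [::] N c) /\ E (color r c) (f k (node_of_pos p)).
Proof.
have [f_adj _ _] := f_cover k.
elim: cs => [//|[[k' p'] c'] cs IHcs] snd_cs /=; case: ifP => [|_].
  move=> /and3P[/eqP eq_k /eqP d1 full_c'] [<-]; split=> //.
  have [|_ <-] := snd_cs k' p' c'; first by rewrite inE eqxx.
  by rewrite eq_k in f_adj *; apply: f_adj; rewrite adj_sym adj_node_of_pos.
by apply: IHcs => k1 p1 c1 in_cs; apply: snd_cs; rewrite inE in_cs orbT.
Qed.

(** The color actually present at [p] selects the branch: a link of a full neighbor, a color already
    in [r], or a new one appended to [r]. *)
Lemma assign_sound r s k p : realizes r s ->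
  exists t c s', [/\ c \in candidates s k p, assign s k p c = Some s' &
                     realizes (r ++ t) s'].
Proof.
move=> real_s; have [sndN snd_cs] := real_s; have [uniq_r szN _ linkN] := sndN.
set x := f k (node_of_pos p).
have old c : c < size r -> x = color r c ->
    exists2 s', assign s k p c = Some s' & realizes (r ++ [::]) s'.
  move=> lt_c xc; rewrite /assign szN (ltn_eqF lt_c) cats0.
  exact: place_sound.
rewrite /candidates; case def_c: full_neighbor => [c|].
  have [full_c Ecx] := full_neighbor_sound snd_cs def_c.
  have /(full_linksP _ sndN full_c)[b b_in xb] := Ecx.
  have [lt_b _] := linkN _ _ b_in.
  by have [s' ass real_s'] := old b lt_b xb; exists [::], b, s'.
have [x_in|x_notin] := boolP (x \in r).
  have lt_x : index x r < size r by rewrite index_mem.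
  have [|s' ass real_s'] := old _ lt_x; first by rewrite nth_index.
  by exists [::], (index x r), s'; rewrite mem_iota szN leqW.
have real_fs := fresh_sound real_s x_notin.
have [||s' eq_s' real_s'] :=
  place_sound (k := k) (p := p) (c := size r) real_fs.
- by rewrite size_rcons.
- by rewrite nth_rcons ltnn eqxx.
exists [:: x], (size r), s'; rewrite cats1; split=> //.
  by rewrite mem_iota szN /=.
by rewrite /assign szN eqxx.
Qed.

(** The branch that follows the actual colors never fails and is never pruned. *)
Lemma explore_sound prune order r s :
    (forall r s, realizes r s -> ~~ prune s) -> realizes r s ->
  exists t s', s' \in explore prune order s /\ realizes (r ++ t) s'.
Proof.
move=> prune_sound; elim: order r s => [|[k p] order IH] r s real_s /=;
  rewrite (negPf (prune_sound _ _ real_s)).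
  by exists [::], s; rewrite cats0 inE eqxx.
have [t [c [s1 [c_in ass real_s1]]]] := assign_sound k p real_s.
have [t' [s' [s'_in real_s']]] := IH _ _ real_s1.
exists (t ++ t'), s'; rewrite catA; split=> //.
by apply/flatten_mapP; exists c => //; rewrite ass.
Qed.

Lemma has_twin_labels_sound r s : twin_free E -> realizes r s ->
  ~~ has_twin_labels s.
Proof.
move=> no_twin [sndN _]; have [uniq_r szN _ _] := sndN.
apply/hasPn=> a; rewrite mem_iota szN /= => lt_a; apply/hasPn=> b.
rewrite mem_iota /= => lt_b; apply/negP.
move=> /and4P[full_a full_b /allP sub_a /allP sub_b].
have neq_ab : color r a != color r b.
  by rewrite nth_uniq ?gtn_eqF // (ltn_trans lt_b).
have [c [neq_ca neq_cb]] := no_twin _ _ neq_ab.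
have half a' b' : full (nth [::] s.1 a') -> full (nth [::] s.1 b') ->
    (forall x, x \in nth [::] s.1 a' -> x \in b' :: nth [::] s.1 b') ->
    c != color r b' -> E (color r a') c -> E (color r b') c.
  move=> full_a' full_b' sub neq_c /(full_linksP _ sndN full_a')[x x_in cx].
  apply/(full_linksP _ sndN full_b'); exists x => //.
  have := sub _ x_in; rewrite inE => /orP[/eqP eq_x|//].
  by rewrite cx eq_x eqxx in neq_c.
by case/negP; apply/eqP; apply/idP/idP; apply: half.
Qed.

Lemma label_sound r s k p : realizes r s -> label s k p < size r ->
  f k (node_of_pos p) = color r (label s k p).
Proof.
case: s => N cs [[/= _ szN _ _]]; rewrite /label /= szN.
elim: cs => [|[[k' p'] c] cs IHcs] snd_cs /=; first by rewrite ltnn.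
case: ifP => [/andP[/eqP <- /eqP <-] _|_].
  by have [|//] := snd_cs k' p' c; rewrite inE eqxx.
by apply: IHcs => k1 p1 c1 in_cs; apply: snd_cs; rewrite inE in_cs orbT.
Qed.

End Soundness.

(** * Rigid motions and windows *)

Local Open Scope ring_scope.

(** Preservation of midpoints sends opposite neighbors to opposite neighbors; building it in avoids
    classifying the automorphisms. *)
Definition rigid (phi : node -> node) : Prop :=
  automorphism phi /\
  forall u e, phi (u + e) + phi (u - e) = phi u + phi u.

Lemma automorphism_comp phi psi :
  automorphism phi -> automorphism psi -> automorphism (phi \o psi).
Proof.
move=> [bij_phi adj_phi] [bij_psi adj_psi]; split; first exact: bij_comp.
by move=> u v /=; rewrite adj_phi adj_psi.
Qed.

Lemma rigid_comp phi psi : rigid phi -> rigid psi -> rigid (phi \o psi).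
Proof.
move=> [aut_phi mid_phi] [aut_psi mid_psi]; split.
  exact: automorphism_comp.
move=> u e /=; set d := psi (u + e) - psi u.
have psi_add : psi (u + e) = psi u + d by rewrite [RHS]addrC subrK.
have psi_sub : psi (u - e) = psi u - d.
  apply: (addrI (psi (u + e))).
  by rewrite mid_psi psi_add addrACA subrr addr0.
by rewrite psi_add psi_sub.
Qed.

Lemma rigid_shift o : rigid (+%R o).
Proof.
split; first split.
- by exists (+%R (- o)) => u; rewrite ?addKr ?addNKr.
- by case: o => a b [x y] [x' y']; rewrite /adj /=; lia.
by case: o => a b [x y] [x' y']; congr pair => /=; lia.
Qed.

Definition swap (u : node) : node := (u.2, u.1).
Definition flip (u : node) : node := (u.1, - u.2).

Lemma swapK : involutive swap. Proof. by case. Qed.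
Lemma flipK : involutive flip.
Proof. by case=> x y; rewrite /flip /= opprK. Qed.

Lemma rigid_swap : rigid swap.
Proof.
split; first split.
- by exists swap; exact: swapK.
- by case=> [x y] [x' y']; rewrite /adj /=; lia.
by case=> [x y] [x' y']; congr pair => /=; lia.
Qed.

Lemma rigid_flip : rigid flip.
Proof.
split; first split.
- by exists flip; exact: flipK.
- by case=> [x y] [x' y']; rewrite /adj /=; lia.
by case=> [x y] [x' y']; congr pair => /=; lia.
Qed.

(** Connectedness of the grid, used to propagate local properties. *)
Lemma node_ind (P : node -> Prop) :
  P 0 -> (forall u v, adj u v -> P u -> P v) -> forall u, P u.
Proof.
move=> P0 Padj.
have Px x : P (x, 0).
  elim/int_ind: x => [//|n|n]; apply: Padj; rewrite /adj /=; lia.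
case=> x; elim/int_ind=> [//|n|n]; apply: Padj; rewrite /adj /=; lia.
Qed.

Section Windows.

Variables (C : finType) (E : rel C) (x0 : C).
Hypothesis E_irr : irreflexive E.
Hypothesis E_deg : forall c, #|E c| = 4%N.

Lemma graph_cover_comp f phi :
  graph_cover E f -> automorphism phi -> graph_cover E (f \o phi).
Proof.
move=> [f_adj f_inj f_surj] [bij_phi adj_phi]; split=> [u v|u v w|u c] /=.
- by rewrite -adj_phi; apply: f_adj.
- rewrite -(adj_phi u v) -(adj_phi u w) => adj_v adj_w.
  move=> /(f_inj _ _ _ adj_v adj_w).
  exact: bij_inj.
move=> /f_surj[v adj_v fv]; have [psi _ psiK] := bij_phi.
by exists (psi v); rewrite /= ?psiK // -adj_phi psiK.
Qed.

Definition shows (r : seq C) (f : node -> C) (u : node) (w : seq nat) : Prop :=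
  [/\ size w = size ball2, all (fun c => (c < size r)%N) w &
      [seq f (u + node_of_pos p) | p <- ball2] = [seq nth x0 r c | c <- w]].

Lemma shows_realizes r f u w N : links_sound E x0 r N -> shows r f u w ->
  realizes E (fun=> f \o +%R u) x0 r (window_state N w).
Proof.
move=> sndN [sz_w lt_w eq_w]; split=> //= k p c /mapP[[p' c'] pc_in [_ -> ->]].
have /(nthP ((0, 0)%N, 0%N))[i] := pc_in.
rewrite size_zip sz_w minnn => lt_i; rewrite nth_zip // => -[eq_p eq_c].
split; first by rewrite -eq_c; apply: (allP lt_w); rewrite mem_nth // sz_w.
have := congr1 (fun s => nth x0 s i) eq_w.
by rewrite (nth_map (0, 0)%N) // (nth_map 0%N) ?sz_w // eq_p eq_c.
Qed.

Lemma window_shows r g f u v s e :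
    realizes E g x0 r s -> g false =1 f \o +%R u ->
    {in ball2, forall p, u + node_of_pos (shift_pos e p) = v + node_of_pos p} ->
    all (fun c => (c < size r)%N) (window e s) ->
  shows r f v (window e s).
Proof.
move=> real_s gf sh_uv lt_w; split=> //.
rewrite -map_comp; apply/eq_in_map => p p_in /=.
rewrite -(label_sound real_s) ?gf /= ?sh_uv //.
by apply: (allP lt_w); apply/mapP; exists p.
Qed.

Lemma shifts_adj u v : adj u v -> exists2 sh, sh \in shifts &
  {in ball2, forall p,
    u + node_of_pos (shift_pos sh.1 p) = v + node_of_pos p}.
Proof.
(* Positive coordinates keep the truncated subtraction in [shift_pos] exact. *)
have aux (e q : pos) : (0 < q.1)%N -> (0 < q.2)%N ->
    v = u + (e.1%:Z - 1, e.2%:Z - 1) ->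
    u + node_of_pos (shift_pos e q) = v + node_of_pos q.
  case: e q u v => [a b] [x y] [u1 u2] [v1 v2] /= x_gt0 y_gt0 [-> ->].
  by congr pair => /=; lia.
have pos_gt0 p : p \in ball2 -> (0 < p.1)%N /\ (0 < p.2)%N.
  by move/(allP (isT : all (fun p => (0 < p.1)%N && (0 < p.2)%N) ball2))/andP.
rewrite -mem_nbrs !inE => /or4P[] /eqP def_v;
  [exists (nth ((0, 0), [::])%N shifts 0)
  | exists (nth ((0, 0), [::])%N shifts 1)
  | exists (nth ((0, 0), [::])%N shifts 2)
  | exists (nth ((0, 0), [::])%N shifts 3)];
  rewrite ?mem_nth // => p /pos_gt0[? ?]; apply: aux => //;
  rewrite def_v; case: (u) => [x y]; congr pair => /=; lia.
Qed.

(** Walk from [u] to [v]: at each step the search extends the current ball by its actual colors, and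
    closure keeps the recentered ball in [G]. *)
Lemma shift_closed_sound f r N G u w :
    graph_cover E f -> links_sound E x0 r N ->
    shift_closed N G -> w \in G -> shows r f u w ->
  forall v, exists2 w', w' \in G & shows r f v w'.
Proof.
move=> f_cover sndN closedG w_in show_w v.
have [uniq_r szN _ _] := sndN.
suff: exists2 w', w' \in G & shows r f (u + (v - u)) w'.
  by rewrite addrC subrK.
elim/node_ind: (v - u) => [|x y adj_xy [w1 w1_in show_w1]].
  by exists w; rewrite ?addr0.
have lt_w w2 : w2 \in G -> all (fun c => (c < size r)%N) w2.
  by move/(allP closedG)/and3P=> [_]; rewrite szN.
have cover_x (k : bool) : graph_cover E (f \o +%R (u + x)).
  by apply: graph_cover_comp => //; case: (rigid_shift (u + x)).
have /(allP closedG)/and3P[_ _ /allP closed_w1] := w1_in.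
have [|sh sh_in sh_xy] := @shifts_adj (u + x) (u + y).
  have [[_ adj_u] _] := rigid_shift u.
  by rewrite adj_u.
have [t [s [s_in real_s]]] := explore_sound E_irr E_deg cover_x
  [seq (false, p) | p <- sh.2] (fun r s _ => isT : ~~ xpred0 s)
  (shows_realizes sndN show_w1).
have /andP[/eqP sz_s win_in] := allP (closed_w1 _ sh_in) _ s_in.
(* The size check leaves no room for new colors, so the same [r] serves along the whole walk. *)
have t_nil : t = [::].
  have [[_ + _ _] _] := real_s; rewrite sz_s szN size_cat.
  by case: (t) => //= ? ?; lia.
rewrite t_nil cats0 in real_s.
exists (window sh.1 s) => //.
by apply: (window_shows real_s) => //; apply: lt_w.
Qed.

Lemma conflict_freeP s : conflict_free s -> exists G,
  [/\ window (1, 1)%N s \in G, shift_closed s.1 G &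
      all (predC conflict_window) G].
Proof.
rewrite /conflict_free.
by move: (window_closure _ _ _ _) => G /and3P[]; exists G.
Qed.

Lemma survivorsP s : s \in survivors -> conflict_free s.
Proof. exact: (allP survivors_conflict_free). Qed.

Lemma conflict_survives r g : twin_free E -> (forall k, graph_cover E (g k)) ->
    realizes E g x0 r conflict ->
  exists t s, s \in survivors /\ realizes E g x0 (r ++ t) s.
Proof.
move=> no_twin g_cover; apply: explore_sound => // r' s'.
exact: has_twin_labels_sound.
Qed.

(** The patches of [f] and [f \o phi] around 0 realize [conflict], hence some survivor. Its closed
    family describes every ball of radius 2 of [f], yet the ball at [phi 0] has labels 1 and 3 on
    opposite sides of label 0. *)
Lemma conflict_impossible f phi : twin_free E -> graph_cover E f -> rigid phi ->
    f (phi 0) = f 0 -> f (phi (1, 0)) = f (1, 0) ->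
    f (phi (-1, 0)) = f (0, 1) -> f (phi (0, 1)) = f (-1, 0) ->
  f (phi (0, -1)) = f (0, -1) -> False.
Proof.
move=> no_twin f_cover rigid_phi g0 gR gL gU gD.
have [aut_phi mid_phi] := rigid_phi.
pose g (k : bool) := if k then f \o phi else f.
have g_cover k : graph_cover E (g k).
  by case: k => //; apply: graph_cover_comp.
pose r := [:: f 0; f (1, 0); f (-1, 0); f (0, 1); f (0, -1)].
have real0 : realizes E g x0 r conflict.
  have [f_adj f_inj f_surj] := f_cover.
  have neq_adj u v : adj u v -> f u != f v.
    by move=> /f_adj Euv; apply: contraTneq Euv => ->; rewrite E_irr.
  have neq_nbr u v : adj 0 u -> adj 0 v -> u != v -> f u != f v.
    by move=> adj_u adj_v; apply: contra_neq => /(f_inj _ _ _ adj_u adj_v).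
  have uniq_r : uniq r.
    rewrite /= !inE !negb_or; do ?[apply/andP; split] => //;
      first [by apply: neq_adj | by apply: neq_nbr].
  split; first split=> //.
  - by do 6?case=> //.
  - have f_adj' u v : adj v u -> E (f u) (f v) by rewrite adj_sym; apply: f_adj.
    move=> a b; do 5?[case: a => [|a]] => //=; rewrite ?nth_nil ?inE //.
    + by case/or4P=> /eqP->; split=> //; apply: f_adj.
    + by move=> /eqP->; split=> //; apply: f_adj'.
    + by move=> /eqP->; split=> //; apply: f_adj'.
    + by move=> /eqP->; split=> //; apply: f_adj'.
    + by move=> /eqP->; split=> //; apply: f_adj'.
  move=> k p c; rewrite /conflict /= !inE.
  by do 9?case/orP; move=> /eqP[-> -> ->]; split.
have [t [s [s_in real_s]]] := conflict_survives no_twin g_cover real0.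
have [G [win_in closedG /allP freeG]] := conflict_freeP (survivorsP s_in).
clear s_in real0.
have [sndN _] := real_s; have [uniq_r szN _ _] := sndN.
have ltG w : w \in G ->
    all (fun c => (c < size (r ++ t))%N) w.
  by move/(allP closedG)/and3P=> [_]; rewrite szN.
have show0 : shows (r ++ t) f 0 (window (1, 1)%N s).
  apply: (window_shows (u := 0) real_s) (ltG _ win_in) => [u|p _] /=.
    by rewrite add0r.
  by case: p => x y; rewrite /shift_pos /= !addnK.
have [w w_in [sz_w lt_w eq_w]] :=
  shift_closed_sound f_cover sndN closedG win_in show0 (phi 0).
(* Distinct labels name distinct colors, so a color in the window determines its label. *)
have wE i c : (i < size ball2)%N -> (c < size r)%N ->
    f (phi 0 + node_of_pos (nth (0, 0)%N ball2 i)) = nth x0 r c ->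
    nth 0%N w i = c.
  move=> lt_i lt_c fc; apply/eqP.
  have lt_wi : (nth 0%N w i < size (r ++ t))%N.
    by apply: (allP lt_w); rewrite mem_nth // sz_w.
  have lt_c' : (c < size (r ++ t))%N by rewrite size_cat ltn_addr.
  rewrite -(nth_uniq x0 lt_wi lt_c' uniq_r) [X in _ == X]nth_cat lt_c -fc.
  have := congr1 (fun z => nth x0 z i) eq_w.
  by rewrite (nth_map (0, 0)%N) // (nth_map 0%N) ?sz_w // => <-.
(* By the midpoint property [phi] sends (1, 0) and (-1, 0) to opposite sides of [phi 0], in the
   unknown direction [e]. *)
pose e := phi (1, 0) - phi 0.
have phi_e : phi (1, 0) = phi 0 + e by rewrite [RHS]addrC subrK.
have phi_Ne : phi (-1, 0) = phi 0 - e.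
  apply: (addrI (phi (1, 0))); rewrite {2}phi_e addrACA subrr addr0.
  have := mid_phi 0 (1, 0); rewrite add0r.
  by have -> : 0 - (1, 0) = (-1, 0) :> node by [].
have adj_e : adj 0 e.
  have [[_ adj_shift] _] := rigid_shift (phi 0).
  by rewrite -(adj_shift 0 e) addr0 -phi_e; case: aut_phi => _ ->.
have eR := etrans (congr1 f (esym phi_e)) gR.
have eL := etrans (congr1 f (esym phi_Ne)) gL.
have w0 : nth 0%N w 0 = 0%N.
  apply: wE => //=; rewrite -g0; congr f; rewrite -[RHS]addr0; congr (_ + _).
have /negP[] := freeG _ w_in; rewrite /conflict_window w0 eqxx /=.
move: adj_e eR eL; rewrite -mem_nbrs !inE => /or4P[] /eqP-> eR eL.
- by rewrite (wE 1%N 1%N) // (wE 2%N 3%N).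
- by rewrite (wE 2%N 1%N) // (wE 1%N 3%N).
- by rewrite (wE 3%N 1%N) // (wE 4%N 3%N) ?orbT.
- by rewrite (wE 4%N 1%N) // (wE 3%N 3%N) ?orbT.
Qed.

End Windows.

Lemma rigid_id : rigid id.
Proof.
split; first by split=> //; exists id.
by case=> [x y] [x' y']; congr pair => /=; lia.
Qed.

(** Each motion is the translation to [u] after a symmetry fixing 0 that sends (1, 0) to the
    required unit vector. *)
Lemma rigid_frame u v : adj u v ->
  exists psi, [/\ rigid psi, psi 0 = u & psi (1, 0) = v].
Proof.
have turn := rigid_comp rigid_flip rigid_swap.
rewrite -mem_nbrs !inE => /or4P[] /eqP->;
  [exists (+%R u \o id) | exists (+%R u \o (swap \o (flip \o swap)))
  | exists (+%R u \o swap) | exists (+%R u \o (flip \o swap))]; split.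
all: try by case: u => x y; congr pair => /=; lia.
all: apply: rigid_comp (rigid_shift u) _ => //.
- exact: rigid_id.
- exact: rigid_comp rigid_swap turn.
- exact: rigid_swap.
Qed.

(** * Alignment of equally colored nodes *)

Section Alignment.

Variables (C : finType) (E : rel C).
Hypothesis E_irr : irreflexive E.
Hypothesis E_deg : forall c, #|E c| = 4%N.
Hypothesis no_twin : twin_free E.

(** Both neighborhoods carry the same four distinct colors; once two are matched, the other two
    match in one of two orders. *)
Lemma remaining_pair f g u u' a b c d a' b' c' d' :
    graph_cover E f -> graph_cover E g ->
    perm_eq [:: a; b; c; d] (nbrs u) -> perm_eq [:: a'; b'; c'; d'] (nbrs u') ->
    f u = g u' -> f a = g a' -> f b = g b' ->
  (f c = g c' /\ f d = g d') \/ (f c = g d' /\ f d = g c').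
Proof.
move=> [f_adj f_inj _] [g_adj g_inj g_surj] perm_u perm_u' eq_u eq_a eq_b.
have nbr x : x \in [:: a; b; c; d] -> adj u x.
  by rewrite (perm_mem perm_u) mem_nbrs.
have nbr' x : x \in [:: a'; b'; c'; d'] -> adj u' x.
  by rewrite (perm_mem perm_u') mem_nbrs.
have neq x y : x \in [:: a; b; c; d] -> y \in [:: a; b; c; d] ->
    x != y -> f x <> f y.
  by move=> /nbr adj_x /nbr adj_y /eqP neq_xy /(f_inj _ _ _ adj_x adj_y).
have match_nbr x : x \in [:: a; b; c; d] ->
    [\/ f x = f a, f x = f b, f x = g c' | f x = g d'].
  move=> /nbr/f_adj; rewrite eq_u => /g_surj[y].
  rewrite -mem_nbrs -(perm_mem perm_u') !inE.
  by case/or4P=> /eqP-> <-; rewrite ?eq_a ?eq_b;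
    [constructor 1 | constructor 2 | constructor 3 | constructor 4].
have : uniq [:: a; b; c; d] by rewrite (perm_uniq perm_u) uniq_nbrs.
rewrite /= !inE !negb_or !andbT.
case/and3P=> /and3P[ab ac ad] /andP[bc bd] cd.
have in_a : a \in [:: a; b; c; d] by rewrite !inE eqxx.
have in_b : b \in [:: a; b; c; d] by rewrite !inE eqxx orbT.
have in_c : c \in [:: a; b; c; d] by rewrite !inE eqxx !orbT.
have in_d : d \in [:: a; b; c; d] by rewrite !inE eqxx !orbT.
have := neq _ _ in_a in_c ac; have := neq _ _ in_a in_d ad.
have := neq _ _ in_b in_c bc; have := neq _ _ in_b in_d bd.
have := neq _ _ in_c in_d cd.
by case: (match_nbr c in_c) => ->; case: (match_nbr d in_d) => -> //;
  move=> *; try congruence; [left | right].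
Qed.

(** The remaining two neighbors match in two ways: one is the position of [conflict], the other
    becomes it after [flip]. *)
Lemma opposite_not_adjacent f phi : graph_cover E f -> rigid phi ->
    f (phi 0) = f 0 -> f (phi (1, 0)) = f (1, 0) ->
  f (phi (-1, 0)) = f (0, 1) -> False.
Proof.
move=> f_cover rigid_phi g0 gR gL; have [aut_phi _] := rigid_phi.
have g_cover := graph_cover_comp f_cover aut_phi.
have [] := @remaining_pair f (f \o phi) 0 0 (1, 0) (0, 1) (-1, 0) (0, -1)
  (1, 0) (-1, 0) (0, 1) (0, -1) f_cover g_cover isT isT; rewrite //=.
  case=> gU gD.
  by apply: (conflict_impossible (f 0) E_irr E_deg no_twin f_cover rigid_phi).
case=> gD gU.
by apply: (conflict_impossible (f 0) E_irr E_deg no_twin f_cover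
  (rigid_comp rigid_phi rigid_flip)).
Qed.

Definition agree (f g : node -> C) (u : node) : Prop :=
  f u = g u /\ forall v, adj u v -> f v = g v.

Lemma align f phi : graph_cover E f -> rigid phi -> f (phi 0) = f 0 ->
  exists sigma, [/\ rigid sigma, sigma 0 = 0 & agree f (f \o phi \o sigma) 0].
Proof.
move=> f_cover rigid_phi g0.
have [psi [rigid_psi psi0 gR]] : exists psi,
    [/\ rigid psi, psi 0 = 0 & f (phi (psi (1, 0))) = f (1, 0)].
  have [f_adj _ _] := f_cover.
  have [_ _ g_surj] := graph_cover_comp f_cover (proj1 rigid_phi).
  have [|v adj_v gv] := g_surj 0 (f (1, 0)).
    by rewrite /= g0; apply: f_adj.
  have [psi [rigid_psi psi0 psiR]] := rigid_frame adj_v.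
  by exists psi; rewrite psiR.
have {rigid_phi} rigid_g := rigid_comp rigid_phi rigid_psi.
have g_cover := graph_cover_comp f_cover (proj1 rigid_g).
pose g := f \o (phi \o psi).
have {}g0 : g 0 = f 0 by rewrite /g /= psi0.
have [f_adj f_inj f_surj] := f_cover; have [g_adj g_inj g_surj] := g_cover.
(* Local injectivity excludes the color on the right, and [opposite_not_adjacent], directly or
   reflected, those above and below. *)
have gL : g (-1, 0) = f (-1, 0).
  have [|v] := f_surj 0 (g (-1, 0)); first by rewrite -g0; apply: g_adj.
  rewrite -mem_nbrs !inE => /or4P[] /eqP-> //= fv.
  - have /(g_inj 0) : g (1, 0) = g (-1, 0) by rewrite /g /= gR fv.
    by move=> /(_ isT isT).
  - by case: (opposite_not_adjacent f_cover rigid_g).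
  have flip_cover := graph_cover_comp f_cover (proj1 rigid_flip).
  have rigid_flip_g := rigid_comp rigid_flip rigid_g.
  by case: (opposite_not_adjacent flip_cover rigid_flip_g) => /=;
    rewrite flipK.
have [] := @remaining_pair f g 0 0 (1, 0) (-1, 0) (0, 1) (0, -1)
  (1, 0) (-1, 0) (0, 1) (0, -1) f_cover g_cover isT isT;
  rewrite // => -[eqU eqD].
  exists psi; split=> //; split=> [|v]; first by rewrite -g0.
  by rewrite -mem_nbrs !inE => /or4P[] /eqP->.
exists (psi \o flip); split; [exact: rigid_comp rigid_psi rigid_flip|by []|].
split=> [|v]; first by rewrite -g0.
by rewrite -mem_nbrs !inE => /or4P[] /eqP->.
Qed.

(** Aligning at [v] gives a rigid [sigma] that fixes [- e] by local injectivity, hence fixes [e] by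
    the midpoint property. *)
Lemma straight f phi v e : graph_cover E f -> rigid phi -> adj v (v - e) ->
    f v = f (phi v) -> f (v - e) = f (phi (v - e)) ->
  f (v + e) = f (phi (v + e)).
Proof.
move=> f_cover rigid_phi adj_e fv fNe.
have [shift_aut _] := rigid_shift v.
(* Conjugation by the translation moves [v] to the origin, where [align] applies. *)
pose phi1 := +%R (- v) \o (phi \o +%R v).
have phi1E x : v + phi1 x = phi (v + x) by rewrite /phi1 /= addNKr.
have rigid_phi1 : rigid phi1.
  by apply/rigid_comp/rigid_comp; rewrite //; apply: rigid_shift.
have [|sigma [[[sigma_bij adj_sigma] mid_sigma] sigma0 [_ eq_sigma]]] :=
  align (graph_cover_comp f_cover shift_aut) rigid_phi1.
  by rewrite /= phi1E addr0.
have adj0 x : adj 0 x = adj v (v + x).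
  by have [_ adj_shift] := shift_aut; rewrite -(adj_shift 0 x) addr0.
have adj_Ne : adj 0 (- e) by rewrite adj0.
have sigma_Ne : sigma (- e) = - e.
  have [_ g_inj _] := graph_cover_comp f_cover (proj1 rigid_phi).
  apply: (addrI v); apply: (g_inj v) => //.
    by rewrite -adj0 -sigma0 adj_sigma.
  by have := eq_sigma _ adj_Ne; rewrite /= phi1E -fNe.
have sigma_e : sigma e = e.
  have := mid_sigma 0 e; rewrite !add0r sigma0 addr0 sigma_Ne => /eqP.
  by rewrite subr_eq0 => /eqP.
have adj_e0 : adj 0 e.
  by move: adj_Ne; case: (e) => x y; rewrite /adj /=; lia.
by have := eq_sigma _ adj_e0; rewrite /= phi1E sigma_e.
Qed.

(** A mismatch at (1, 1) exchanges the side colors around (1, 0), hence also around (0, -1), which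
    forces corners (1, 1) and (-1, -1) to share a color. Every neighbor of 0 is adjacent to one of
    these corners, so that color is a twin of [f 0]. *)
Lemma corner_agree f g : graph_cover E f -> graph_cover E g -> agree f g 0 ->
    f (2, 0) = g (2, 0) -> f (0, 2) = g (0, 2) -> f (0, -2) = g (0, -2) ->
  f (1, 1) = g (1, 1).
Proof.
move=> f_cover g_cover [eq0 eq1] eqR eqU eqD.
have [f_adj f_inj f_surj] := f_cover.
have [] := @remaining_pair f g (1, 0) (1, 0) 0 (2, 0) (1, 1) (1, -1)
  0 (2, 0) (1, 1) (1, -1) f_cover g_cover isT isT (eq1 (1, 0) isT) eq0 eqR.
  by case.
case=> eqR1 eqR2.
have [] := @remaining_pair f g (0, 1) (0, 1) 0 (0, 2) (1, 1) (-1, 1)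
  0 (0, 2) (1, 1) (-1, 1) f_cover g_cover isT isT (eq1 (0, 1) isT) eq0 eqU.
  by case.
case=> _ eqU2.
have [] := @remaining_pair f g (0, -1) (0, -1) 0 (0, -2) (1, -1) (-1, -1)
  0 (0, -2) (1, -1) (-1, -1) f_cover g_cover isT isT (eq1 (0, -1) isT) eq0 eqD.
  move=> [eqD1 _]; have : f (1, 1) = f (1, -1) by rewrite eqR1 eqD1.
  by move=> /(f_inj (1, 0)) => /(_ isT isT).
case=> _ eqD2.
have eq_corner : f (-1, -1) = f (1, 1) by rewrite eqD2 eqR1.
have neq : f 0 != f (1, 1).
  by apply/eqP => /(f_inj (1, 0)) => /(_ isT isT).
have [c [_ _]] := no_twin neq; case/negP; apply/eqP.
have sub : E (f 0) \subset E (f (1, 1)).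
  apply/subsetP=> x /f_surj[v]; rewrite -mem_nbrs !inE.
  by case/or4P=> /eqP-> <-;
    first [exact: f_adj | rewrite -eq_corner; exact: f_adj].
have /subset_cardP/(_ sub) eqE : #|E (f 0)| = #|E (f (1, 1))| by rewrite !E_deg.
exact: eqE.
Qed.

(** In a frame with [u] at 0 and [v] at (1, 0), the neighbors of [v] are 0, the point (2, 0) given
    by [straight], and two corners given by [corner_agree], the second through [flip]. *)
Lemma agree_adj f phi u v : graph_cover E f -> rigid phi -> adj u v ->
  agree f (f \o phi) u -> agree f (f \o phi) v.
Proof.
move=> f_cover rigid_phi adj_uv agree_u.
have g_cover := graph_cover_comp f_cover (proj1 rigid_phi).
have [psi [rigid_psi psi0 psiR]] := rigid_frame adj_uv.
have around rho : rigid rho -> rho 0 = u ->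
    agree (f \o rho) (f \o phi \o rho) 0 /\
    forall e, adj 0 e -> f (rho (e + e)) = f (phi (rho (e + e))).
  move=> [[rho_bij adj_rho] mid_rho] rho0; have [eq_u eq_nbr] := agree_u.
  have eq0 e : adj 0 e -> f (rho e) = f (phi (rho e)).
    by move=> adj_e; apply: eq_nbr; rewrite -rho0 adj_rho.
  split; first by split=> [|x adj_x] /=; rewrite ?rho0 ?eq0.
  move=> e adj_e; pose d := rho e - rho 0.
  have rhoN : rho e - d = rho 0 by rewrite /d opprB addrC subrK.
  have rhoD : rho e + d = rho (e + e).
    apply: (addIr (rho 0)); rewrite -{1}rhoN addrACA subrr addr0.
    by have := mid_rho e e; rewrite subrr => ->.
  rewrite -rhoD; apply: (straight f_cover rigid_phi); rewrite ?rhoN ?rho0 //.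
    by rewrite -rho0 adj_rho adj_sym.
  exact: eq0.
have corner rho : rigid rho -> rho 0 = u ->
    f (rho (1, 1)) = f (phi (rho (1, 1))).
  move=> rigid_rho rho0; have [agree0 axis] := around _ rigid_rho rho0.
  apply: (corner_agree (f := f \o rho) (g := f \o phi \o rho)) => //.
  - exact: graph_cover_comp (proj1 rigid_rho).
  - exact: graph_cover_comp (proj1 rigid_rho).
  - exact: (axis (1, 0)).
  - exact: (axis (0, 1)).
  - exact: (axis (0, -1)).
have [[eq0 eq1] axis] := around _ rigid_psi psi0.
split; first by rewrite -psiR; exact: eq1.
move=> w adj_w; have [[[chi psiK chiK] adj_psi] _] := rigid_psi.
have adj_chi : adj (1, 0) (chi w) by rewrite -adj_psi chiK psiR.
rewrite -[w]chiK; move: (chi w) adj_chi => x.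
rewrite -mem_nbrs !inE => /or4P[] /eqP->.
- exact: (axis (1, 0)).
- exact: eq0.
- exact: corner.
exact: (corner (psi \o flip) (rigid_comp rigid_psi rigid_flip)).
Qed.

Lemma cover_homogeneous f u v : graph_cover E f -> f u = f v ->
  exists h, [/\ automorphism h, h u = v & forall x, f (h x) = f x].
Proof.
move=> f_cover eq_uv.
have fu_cover := graph_cover_comp f_cover (proj1 (rigid_shift u)).
have shiftE x : u + (v - u + x) = v + x by rewrite addrA [u + _]addrC subrK.
have [|sigma [rigid_sigma sigma0 agree0]] :=
  align fu_cover (rigid_shift (v - u)).
  by rewrite /= shiftE !addr0.
have rigid_g := rigid_comp (rigid_shift (v - u)) rigid_sigma.
have agree_all x :
    agree (f \o +%R u) ((f \o +%R u) \o (+%R (v - u) \o sigma)) x.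
  elim/node_ind: x => [//|x y adj_xy].
  exact: agree_adj.
exists (+%R v \o (sigma \o +%R (- u))); split.
- apply: automorphism_comp (automorphism_comp _ _);
    by [case: (rigid_shift v) | case: rigid_sigma | case: (rigid_shift (- u))].
- by rewrite /= addNr sigma0 addr0.
move=> x; have [] := agree_all (- u + x).
by rewrite /= shiftE addNKr => ->.
Qed.

End Alignment.

(** * Coverings of the grid *)

(** The group is that of all color-preserving automorphisms. *)
Lemma orbit_of_homogeneous (C : finType) (F : node -> C) :
    (forall u v, F u = F v ->
       exists h, [/\ automorphism h, h u = v & forall x, F (h x) = F x]) ->
  orbit_coloring F.
Proof.
move=> homF; exists (fun h => automorphism h /\ forall x, F (h x) = F x).
  split.
  - by move=> h [].
  - by split=> //; split=> //; exists id.
  - move=> h k [aut_h Fh] [aut_k Fk]; split; first exact: automorphism_comp.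
    by move=> x /=; rewrite Fh Fk.
  move=> h [[[k hK kK] adj_h] Fh]; exists k; split=> //; split; last first.
    by move=> x; rewrite -Fh kK.
  by split=> [|u v]; [exists h | rewrite -adj_h !kK].
move=> u v; split=> [/homF[h [aut_h hu Fh]]|[h [_ Fh] <-]]; first by exists h.
by rewrite Fh.
Qed.

Section Covering.

Variables (n : nat) (F : node -> 'I_n) (S : 'M[nat]_n).
Hypothesis F_covering : covering F S.

Let E : rel 'I_n := fun i j => S i j == 1%N.

Lemma covering_count u j : count (fun v => F v == j) (nbrs u) = S (F u) j.
Proof. by have [[_ _ F_count] _ _] := F_covering; apply: F_count. Qed.

(** A positive count gives adjacency, a count at most 1 local injectivity, a count equal to 1 a
    neighbor of that color. *)
Lemma covering_graph_cover : graph_cover E F.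
Proof.
have [_ S01 _] := F_covering; split=> [u v|u v w|u j].
- rewrite -mem_nbrs => v_in; rewrite /E.
  have : (0 < S (F u) (F v))%N.
    by rewrite -covering_count -has_count; apply/hasP; exists v.
  by case: (S01 (F u) (F v)) => ->.
- rewrite -!mem_nbrs => v_in w_in eq_vw.
  have : (size [seq x <- nbrs u | F x == F v] <= 1)%N.
    by rewrite size_filter covering_count; case: (S01 (F u) (F v)) => ->.
  have : v \in [seq x <- nbrs u | F x == F v] by rewrite mem_filter eqxx.
  have : w \in [seq x <- nbrs u | F x == F v] by rewrite mem_filter eq_vw eqxx.
  by case: filter => [|x [|]] //; rewrite !inE => /eqP-> /eqP->.
rewrite /E -covering_count => /eqP S1.
have /hasP[v v_in /eqP Fv] : has (fun v => F v == j) (nbrs u).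
  by rewrite has_count S1.
by exists v; rewrite -?mem_nbrs.
Qed.

Lemma covering_sym i j : S i j = S j i.
Proof.
have [[_ F_surj _] S01 _] := F_covering.
have [F_adj _ F_nbr] := covering_graph_cover.
have E_sym a b : E a b -> E b a.
  have [u <-] := F_surj a (in_setT a) => /F_nbr[v adj_uv <-].
  by apply: F_adj; rewrite adj_sym.
have := E_sym i j; have := E_sym j i; rewrite /E.
by case: (S01 i j) => ->; case: (S01 j i) => -> //;
  [move/(_ isT) | move=> _ /(_ isT)].
Qed.

Lemma covering_degree i : #|E i| = 4%N.
Proof.
have [[_ F_surj _] _ _] := F_covering.
have [F_adj F_inj F_nbr] := covering_graph_cover.
have [u <-] := F_surj i (in_setT i).
have uniq_F : uniq (map F (nbrs u)).
  rewrite map_inj_in_uniq ?uniq_nbrs // => v w.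
  by rewrite !mem_nbrs; apply: F_inj.
rewrite -[RHS]/(size (map F (nbrs u))) -(card_uniqP uniq_F).
apply: eq_card => j.
apply/idP/mapP=> [/F_nbr[v adj_uv <-]|[v]].
  by exists v; rewrite ?mem_nbrs.
by rewrite mem_nbrs => adj_uv ->; apply: F_adj.
Qed.

Lemma covering_twin a b : a != b ->
  (forall c, c != a -> c != b -> S a c = S b c) -> twin F a b.
Proof.
move=> neq_ab eq_ab; split; first exact/eqP.
have [[_ F_surj _] _ S_diag] := F_covering.
(* Column [a] of the merged matrix collects the neighbors of colors [a] and [b]. *)
exists (fun i j => if j == a then S i a + S i b else S i j)%N; split.
- by move=> u; rewrite !inE /= /identify; case: ifP => // /negbT.
- move=> c; rewrite !inE => neq_cb; have [u Fu] := F_surj c (in_setT c).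
  by exists u; rewrite /= /identify Fu (negPf neq_cb).
move=> i j; rewrite !inE => neq_ib neq_jb u Fu.
transitivity (if j == a then S (F u) a + S (F u) b else S (F u) j)%N.
  rewrite -!covering_count; have [->|neq_ja] := eqVneq j a.
    rewrite -count_predUI [X in (_ + X)%N](_ : _ = 0%N) ?addn0.
      apply: eq_count => v /=; rewrite /identify.
      by case: (eqVneq (F v) b) => [->|_]; rewrite ?eqxx ?orbT ?orbF.
    apply/eqP; rewrite -leqn0 leqNgt -has_count; apply/hasP=> -[v _ /=].
    by case/andP=> /eqP->; rewrite (negPf neq_ab).
  apply: eq_count => v /=; rewrite /identify.
  case: (eqVneq (F v) b) => [->|//]; rewrite eq_sym (negPf neq_ja).
  by rewrite eq_sym (negPf neq_jb).
move: Fu; rewrite /= /identify; case: eqP => [-> <-|_ -> //].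
case: eqVneq => [_|neq_ja]; last by rewrite -eq_ab.
(* A node of color [b] has [S b a + S b b] neighbors of the merged color; zero diagonal and symmetry
   make this [S a a + S a b]. *)
by rewrite !S_diag covering_sym addnC.
Qed.

End Covering.

Theorem theorem1 (n : nat) (F : node -> 'I_n) (S : 'M[nat]_n) :
  covering F S ->
  orbit_coloring F \/ exists a b : 'I_n, twin F a b.
Proof.
move=> F_covering; pose E : rel 'I_n := fun i j => S i j == 1%N.
have [_ S01 S_diag] := F_covering.
(* Either two rows of [S] agree outside their own two columns, giving twins, or [E] is twin-free. *)
have [/existsP[a /existsP[b /andP[neq_ab /forallP eq_ab]]]|/existsPn no_twin] :=
  boolP [exists a, exists b, (a != b) &&
           [forall c, (c != a) && (c != b) ==> (S a c == S b c)]].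
  right; exists a, b; apply: (covering_twin F_covering) => // c neq_ca neq_cb.
  by have := eq_ab c; rewrite neq_ca neq_cb => /eqP.
left; apply: orbit_of_homogeneous => u v; apply: (@cover_homogeneous _ E).
- by move=> i; rewrite /E S_diag.
- exact: covering_degree F_covering.
- move=> a b neq_ab; have /existsPn/(_ b) := no_twin a.
  rewrite neq_ab => /forallPn[c].
  rewrite negb_imply => /andP[/andP[neq_ca neq_cb]].
  move=> neq_S; exists c; split=> //; move: neq_S; rewrite /E.
  by case: (S01 a c) => ->; case: (S01 b c) => ->.
exact: covering_graph_cover F_covering.
Qed.
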